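(* Let $D$ be any distribution over $\mathcal{X}\times\{\pm1\}$ with class-probability function $\eta$ and base rate $\pi$. Suppose $\bar D=\mathrm{BCN}^+(D,f_{-1},f_1,s_0)$, where $(f_{-1},f_1,s_0,\eta)$ are $\mathrm{BCN}^+$-admissible, let $\rho_y=f_y\circ s_0$ for $y\in\{\pm1\}$, and suppose $$\rho_{\max}=\tfrac12\cdot\max_{x\in\mathcal{X}}\big(\rho_1(x)+\rho_{-1}(x)\big)<\tfrac12.$$ Let $\bar\pi$ be the base rate of $\bar D$. Then for any scorer $s\colon\mathcal{X}\to\mathbb{R}$, $$\mathrm{reg}_{\mathrm{rank}}(s;D)\le\frac{\bar\pi(1-\bar\pi)}{\pi(1-\pi)}\cdot\frac{1}{1-2\rho_{\max}}\cdot\mathrm{reg}_{\mathrm{rank}}(s;\bar D).$$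
   Context: $\mathcal{X}$ is an instance space; all functions are taken to be measurable. A distribution $D$ over $\mathcal{X}\times\{\pm1\}$ of a pair $(X,Y)$ has marginal $M=\mathbb{P}(X)$, class-probability function $\eta(x)=\mathbb{P}(Y=1\mid X=x)$, base rate $\pi=\mathbb{P}(Y=1)\in(0,1)$, and class-conditional distributions $P=\mathbb{P}(X\mid Y=1)$, $Q=\mathbb{P}(X\mid Y=-1)$. A scorer is any $s\colon\mathcal{X}\to\mathbb{R}$. The ranking risk is $R_{\mathrm{rank}}(s;D)=\mathbb{E}_{X\sim P,\,X'\sim Q}[\ell^{01}_1(s(X)-s(X'))]$ with $X,X'$ independent and $\ell^{01}_1(v)=\mathbf{1}[v<0]+\tfrac12\mathbf{1}[v=0]$ (one minus the area under the ROC curve). The ranking regret is $\mathrm{reg}_{\mathrm{rank}}(s;D)=R_{\mathrm{rank}}(s;D)-\inf_{t}R_{\mathrm{rank}}(t;D)$, the infimum over all scorers $t$. Instance- and label-dependent noise: for $\rho_1,\rho_{-1}\colon\mathcal{X}\to[0,1]$, $\mathrm{ILN}(D,\rho_{-1},\rho_1)$ is the distribution of $(X,\bar Y)$ obtained by drawing $(X,Y)\sim D$ and flipping the label with probability $\rho_Y(X)$. $\mathrm{BCN}^+$ model: given $f_{\pm1}\colon\mathbb{R}\to[0,1]$ and $s_0\colon\mathcal{X}\to\mathbb{R}$, $\mathrm{BCN}^+(D,f_{-1},f_1,s_0)=\mathrm{ILN}(D,\rho_{-1},\rho_1)$ with $\rho_y=f_y\circ s_0$. The tuple $(f_{-1},f_1,s_0,\eta)$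 is $\mathrm{BCN}^+$-admissible if: (a) for all $x,x'\in\mathcal{X}$, $\eta(x)<\eta(x')\implies s_0(x)<s_0(x')$; (b) $f_{\pm1}$ are non-decreasing where $\eta\le\frac12$ and non-increasing where $\eta\ge\frac12$, i.e. for $y\in\{\pm1\}$ and all $x,x'$ with $s_0(x)\le s_0(x')$: if $\eta(x),\eta(x')\le\frac12$ then $f_y(s_0(x))\le f_y(s_0(x'))$, and if $\eta(x),\eta(x')\ge\frac12$ then $f_y(s_0(x))\ge f_y(s_0(x'))$; (c) $\Delta(z)=f_1(z)-f_{-1}(z)$ is non-increasing in $z$. *)

(* Defs.v *)
From HB Require Import structures.
From mathcomp Require Import all_boot all_order all_algebra.
From mathcomp Require Import all_classical all_reals all_analysis.
From mathcomp Require Import measurable_realfun.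

Set Implicit Arguments.
Unset Strict Implicit.
Unset Printing Implicit Defensive.

Import Order.TTheory GRing.Theory Num.Theory.
Import numFieldNormedType.Exports.

Local Open Scope classical_set_scope.
Local Open Scope ring_scope.

(* Labels are booleans: [true] is the label +1 and [false] is the label -1.
   A distribution of a pair (X, Y) is a probability on the product [X * bool].
   All functions are measurable, hence the use of [{mfun _ >-> _}]. *)

Section label_part.
Context d (X : measurableType d) (R : realType).
Variables (D : probability (X * bool)%type R) (y : bool).

(* A |-> P(X \in A, Y = y) *)
Definition label_part (A : set X) : \bar R := D (A `*` [set y]).

Let label_part0 : label_part set0 = 0%E.
Proof. by rewrite /label_part set0X measure0. Qed.

Let label_part_ge0 A : (0 <= label_part A)%E.
Proof. exact: measure_ge0. Qed.

Let label_part_sigma_additive : semi_sigma_additive label_part.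
Proof.
move=> F mF tF mUF; rewrite /label_part.
have -> : (\bigcup_n F n) `*` [set y] = \bigcup_n (F n `*` [set y]).
  apply/seteqP; split => -[x b] /=.
    by case=> -[n _ Fnx] ->; exists n.
  by case=> n _ [/= Fnx ->]; split => //; exists n.
apply: measure_semi_sigma_additive.
- by move=> n; exact: measurableX.
- apply/trivIsetP => i j _ _ ij; rewrite -setXI.
  by move/trivIsetP : tF => -> //; rewrite set0X.
- by rewrite -setX_bigcupl; exact: measurableX.
Qed.

HB.instance Definition _ := isMeasure.Build _ _ _ label_part
  label_part0 label_part_ge0 label_part_sigma_additive.

End label_part.

Section ILN.
Context d (X : measurableType d) (R : realType).
Variables (D : probability (X * bool)%type R) (rhoN rhoP : {mfun X >-> R}).

Definition flip_rate (z : X * bool) : R :=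
  if z.2 then rhoP z.1 else rhoN z.1.

(* The law of (X, Y (+) F) where (X, Y) ~ D and, given (X, Y), F is Bernoulli of
   parameter [flip_rate (X, Y)].  The rates are meant to take values in [0, 1];
   outside of it [bernoulli_prob] is by convention the Dirac mass at [false]. *)
Definition ILN (B : set (X * bool)) : \bar R :=
  (\int[D]_z bernoulli_prob (flip_rate z) [set b | B (z.1, z.2 (+) b)])%E.

Let ILN_meas B : measurable B -> measurable_fun setT
  ((fun z => bernoulli_prob (flip_rate z) [set b | B (z.1, z.2 (+) b)])
    : X * bool -> \bar R).
Proof.
move=> mB.
have mr : measurable_fun setT flip_rate.
  apply: measurable_fun_ifT => //=; apply: measurableT_comp => //.
have mx (b : bool) : measurable_fun setT
    ((fun z => \1_B (z.1, z.2 (+) b)) : X * bool -> R).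
  apply: measurableT_comp => //.
  apply: measurable_fun_pair => //.
  by apply: (@measurableT_comp _ _ _ _ _ _ (addb^~ b) _ snd).
rewrite [X in measurable_fun _ X](_ : _ = fun z : X * bool =>
   (bernoulli_prob (flip_rate z) [set true] * (\1_B (z.1, z.2 (+) true))%:E +
   bernoulli_prob (flip_rate z) [set false] * (\1_B (z.1, z.2 (+) false))%:E)%E).
  apply: emeasurable_funD; apply: emeasurable_funM.
  - exact: (measurableT_comp (measurable_bernoulli_prob2 _)).
  - exact/measurable_EFinP.
  - exact: (measurableT_comp (measurable_bernoulli_prob2 _)).
  - exact/measurable_EFinP.
apply/funext => z.
set U := [set b | _].
suff pU (p : {measure set bool -> \bar R}) : p U =
    (p [set true] * (\1_B (z.1, z.2 (+) true))%:E +
     p [set false] * (\1_B (z.1, z.2 (+) false))%:E)%E by exact: pU.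
have UE : U = (U `&` [set true]) `|` (U `&` [set false]).
  by rewrite -setIUr -setT_bool setIT.
have pE b : p (U `&` [set b]) = (p [set b] * (\1_B (z.1, z.2 (+) b))%:E)%E.
  rewrite indicE; case: (boolP (_ \in B)); rewrite ?inE ?notin_setE => zB.
    rewrite mule1; congr (p _); apply/seteqP; split => [c []//|c -> ].
    by split.
  rewrite mule0 (_ : _ `&` _ = set0) ?measure0//.
  by apply/seteqP; split => // c [] /= Uc cb; apply: zB; rewrite -cb.
rewrite -!pE [in LHS]UE measureU//.
by apply/seteqP; split => // -[] [] [_ ?] [].
Qed.

Let ILN0 : ILN set0 = 0%E.
Proof. by apply: integral0_eq => z _; exact: measure0. Qed.

Let ILN_ge0 B : (0 <= ILN B)%E.
Proof. by apply: integral_ge0 => z _; exact: measure_ge0. Qed.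

Let ILN_sigma_additive : semi_sigma_additive ILN.
Proof.
move=> F mF tF mUF; rewrite [X in _ --> X](_ : _ =
    (\sum_(n <oo) ILN (F n))%E); last first.
  rewrite -integral_nneseries//; last by move=> n; exact: ILN_meas.
  apply: eq_integral => z _.
  rewrite (_ : [set b | _] = \bigcup_n [set b | F n (z.1, z.2 (+) b)])//.
  apply/esym/cvg_lim => //; apply: measure_semi_sigma_additive => //.
  apply/trivIsetP => i j _ _ ij; apply/seteqP; split => // b [/= Fi Fj].
  move/trivIsetP : tF => /(_ i j Logic.I Logic.I ij) tF.
  by have : (F i `&` F j) (z.1, z.2 (+) b) by []; rewrite tF.
by apply: is_cvg_ereal_nneg_natsum_cond => n _ _; exact: ILN_ge0.
Qed.

HB.instance Definition _ := isMeasure.Build _ _ _ ILN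
  ILN0 ILN_ge0 ILN_sigma_additive.

Let ILN_setT : ILN setT = 1%E.
Proof.
transitivity (\int[D]_z (cst 1%E z))%E; last first.
  by rewrite integral_cst//= mul1e; exact: probability_setT.
by apply: eq_integral => z _; exact: probability_setT.
Qed.

HB.instance Definition _ := Measure_isProbability.Build _ _ _ ILN ILN_setT.

End ILN.

HB.instance Definition _ d1 d2 (T1 : measurableType d1) (T2 : measurableType d2)
  := isMeasurableFun.Build _ _ (T1 * T2)%type T1 fst measurable_fst.

Section binary_distributions.
Context d (X : measurableType d) (R : realType).
Implicit Types (D : probability (X * bool)%type R) (s : {mfun X >-> R}).

Definition base_rate D : R := fine (D (setT `*` [set true])).

Definition marginal D : probability X R := distribution D fst.

(* The marginal is only a default value, returned exactly when P(Y = y) = 0. *)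
Definition class_cond D (y : bool) : probability X R :=
  mnormalize (label_part D y) (marginal D).

(* [eta] is a version of x |-> P(Y = 1 | X = x). *)
Definition is_class_prob D (eta : {mfun X >-> R}) : Prop :=
  (forall x, 0 <= eta x <= 1) /\
  forall A, measurable A ->
    D (A `*` [set true]) = (\int[marginal D]_(x in A) (eta x)%:E)%E.

Definition ell01 (v : R) : R := (v < 0)%R%:R + 2^-1 * (v == 0)%:R.

Definition rank_risk s D : \bar R :=
  ('E_(class_cond D true \x class_cond D false)
     [fun z : X * X => ell01 (s z.1 - s z.2)])%E.

Definition rank_regret s D : \bar R :=
  (rank_risk s D - ereal_inf [set rank_risk t D | t in [set: {mfun X >-> R}]])%E.

Definition BCNplus D (fN fP : {mfun R >-> R}) (s0 : {mfun X >-> R})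
    : probability (X * bool)%type R :=
  ILN D (fN \o s0) (fP \o s0).

Definition BCNplus_admissible (fN fP : R -> R) (s0 eta : X -> R) : Prop :=
  [/\ forall x x', eta x < eta x' -> s0 x < s0 x',
      forall (y : bool) x x', let f := if y then fP else fN in
        s0 x <= s0 x' ->
        (eta x <= 2^-1 -> eta x' <= 2^-1 -> f (s0 x) <= f (s0 x')) /\
        (2^-1 <= eta x -> 2^-1 <= eta x' -> f (s0 x') <= f (s0 x)) &
      forall z z', z <= z' -> fP z' - fN z' <= fP z - fN z].

(* Half of the supremum (the maximum, when it is attained) of the total noise. *)
Definition rho_max (rhoN rhoP : X -> R) : R :=
  2^-1 * sup (range (fun x => rhoP x + rhoN x)).

End binary_distributions.

(* Main.v *)
(** Up to the factor [pi (1 - pi)], the ranking risk of [s] is the integral over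
    pairs [(x, y)] drawn from [M \x M] of [eta x (1 - eta y) l(s x - s y)].
    Adding the contribution of [(y, x)] and using [l(-v) = 1 - l(v)], the
    integrand becomes [(eta x - eta y) l(s x - s y)] plus a term that does not
    depend on [s], so [eta] is an optimal scorer and the regret density is
    [(eta x - eta y) (l(s x - s y) - l(eta x - eta y)) >= 0].  The noise keeps
    [M] and replaces [eta] by [etab = eta (1 - rhoP) + (1 - eta) rhoN].
    Admissibility gives [etab x - etab y >= (1 - 2 rho_max) (eta x - eta y)]
    whenever [eta x > eta y], so the two regret densities compare pointwise.
    Only the upper bound [inf <= risk of etab] is needed for the noisy law, and
    on the clean side the comparison is made with every scorer [t] at once. *)

Require Import Defs.
From HB Require Import structures.
From mathcomp Require Import all_boot all_order all_algebra.
From mathcomp Require Import all_classical all_reals all_analysis.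
From mathcomp Require Import measurable_realfun ring lra.

Import Order.TTheory GRing.Theory Num.Theory.
Import numFieldNormedType.Exports.

Local Open Scope classical_set_scope.
Local Open Scope ring_scope.

Import HBNNSimple.

(** * Integration against the image of a measure with density *)

(** Here [nu] is the image under [phi] of the measure with density [g] with respect to [mu].
    Monotone convergence on both sides reduces the formula to simple functions. It serves with [phi]
    a projection, to isolate one label, and with [phi] the identity, for densities. *)
Lemma ge0_integral_transfer {d1 d2} {T1 : measurableType d1}
    {T2 : measurableType d2} {R : realType} (mu : {measure set T1 -> \bar R})
    (nu : {measure set T2 -> \bar R}) (phi : T1 -> T2)
    (g : T1 -> R) (f : T2 -> \bar R) :
  measurable_fun setT phi -> measurable_fun setT g ->
  (forall x, 0 <= g x) ->
  (forall A, measurable A -> nu A = \int[mu]_x (g x * \1_A (phi x))%:E)%E ->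
  measurable_fun setT f -> (forall y, 0 <= f y)%E ->
  (\int[nu]_y f y = \int[mu]_x ((g x)%:E * f (phi x)))%E.
Proof.
move=> mphi mg g0 nuE mf f0.
pose h := nnsfun_approx measurableT mf.
have hf y : EFin \o h^~ y @ \oo --> f y by exact: cvg_nnsfun_approx.
have mind A : measurable A ->
    measurable_fun setT (fun x => g x * \1_A (phi x)).
  by move=> mA; apply: measurable_funM => //; exact: measurableT_comp.
transitivity (limn (fun n => \int[nu]_y (h n y)%:E))%E.
  rewrite -monotone_convergence//.
  - by apply: eq_integral => y _; apply/esym/cvg_lim => //; exact: hf.
  - by move=> n; exact/measurable_EFinP.
  - by move=> n y _; rewrite lee_fin.
  - by move=> y _ m n mn; rewrite lee_fin; exact/lefP/nd_nnsfun_approx.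
transitivity (limn (fun n => \int[mu]_x (g x * h n (phi x))%:E))%E; last first.
  rewrite -monotone_convergence//.
  - apply: eq_integral => x _; apply/cvg_lim => //.
    under eq_fun do rewrite EFinM.
    by apply: cvgeZl => //; exact: hf.
  - move=> n; apply/measurable_EFinP/measurable_funM => //.
    exact: (measurableT_comp (measurable_funPT _)).
  - by move=> n x _; rewrite lee_fin mulr_ge0.
  - move=> x _ m n mn; rewrite lee_fin ler_wpM2l//.
    exact/lefP/nd_nnsfun_approx.
(* What remains concerns one simple function: both integrals split over its finitely many values,
   and [nuE] settles each level set. *)
congr (limn _); apply/funext => n.
under eq_integral do rewrite fimfunE -fsumEFin//.
rewrite ge0_integral_fsum//; last 2 first.
- by move=> r; exact/measurable_EFinP/measurable_funM.
- by move=> r y _; exact: nnfun_muleindic_ge0.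
under [RHS]eq_integral => x _.
  rewrite fimfunE EFinM -fsumEFin// ge0_mule_fsumr; last first.
    by move=> r; exact: nnfun_muleindic_ge0.
  under eq_fsbigr do rewrite -EFinM mulrCA EFinM.
  over.
rewrite [RHS]ge0_integral_fsum//; last 2 first.
- by move=> r; apply: emeasurable_funM => //; exact/measurable_EFinP/mind.
- move=> r x _; have := @nnfun_muleindic_ge0 _ _ _ (h n) r (phi x).
  move=> rh; rewrite -EFinM mulrCA EFinM mule_ge0//.
  by rewrite lee_fin.
apply: eq_fsbigr => r; rewrite inE => -[y _ <-].
under eq_integral do rewrite EFinM.
rewrite !ge0_integralZl//.
- by rewrite integral_indic// setIT nuE.
- by apply/measurable_EFinP/mind.
- by move=> x _; rewrite lee_fin mulr_ge0.
- by rewrite lee_fin.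
- exact/measurable_EFinP.
- by rewrite lee_fin.
Qed.

(** * Class densities with respect to the marginal *)

(** This is [P(Y = y | X = x)]; taking the label as a parameter lets one lemma cover both
    classes. *)
Definition posterior {d} {X : measurableType d} {R : realType}
  (eta : {mfun X >-> R}) (y : bool) : {mfun X >-> R} :=
  if y then eta else 1 - eta.

Lemma posteriorE {d} {X : measurableType d} {R : realType}
    (eta : {mfun X >-> R}) (y : bool) x :
  posterior eta y x = if y then eta x else 1 - eta x.
Proof. by case: y. Qed.

Section class_probability.
Context {d} {X : measurableType d} {R : realType}.
Variables (D : probability (X * bool)%type R) (eta : {mfun X >-> R}).
Hypothesis etaP : is_class_prob D eta.

Lemma posterior_ge0 y x : 0 <= posterior eta y x.
Proof.
by rewrite posteriorE; have /andP[] := etaP.1 x; case: y; rewrite ?subr_ge0.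
Qed.

(** For [true] this is the definition of [eta]. The two labels together give the marginal mass of
    [A] on both sides, so subtracting the [true] part, which is finite, gives the case [false]. *)
Lemma label_part_posterior y A : measurable A ->
  D (A `*` [set y]) =
    (\int[marginal D]_x (posterior eta y x * \1_A x)%:E)%E.
Proof.
move=> mA.
have DT : D (A `*` [set true]) =
    (\int[marginal D]_x (posterior eta true x * \1_A x)%:E)%E.
  rewrite etaP.2// integral_mkcond; apply: eq_integral => x _.
  by rewrite epatch_indic/= EFinM.
case: y => //.
have mF (y : bool) : measurable_fun setT
    (fun x => (posterior eta y x * \1_A x)%:E).
  exact/measurable_EFinP/measurable_funM.
have F0 (y : bool) x : (0 <= (posterior eta y x * \1_A x)%:E)%E.
  by rewrite lee_fin mulr_ge0 ?posterior_ge0.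
have : (D (A `*` [set true]) + D (A `*` [set false]) =
   (\int[marginal D]_x (posterior eta true x * \1_A x)%:E)
   + (\int[marginal D]_x (posterior eta false x * \1_A x)%:E))%E.
  rewrite -measureU//; [|exact: measurableX..|]; last first.
    by apply/seteqP; split => // -[x b] /= [[_ ->] []].
  rewrite -ge0_integralD//.
  transitivity (marginal D A).
    congr (D _); apply/seteqP; split => -[x b] /=; first by case=> -[].
    by case: b => ?; [left|right].
  rewrite -[in LHS](setIT A) -integral_indic//; apply: eq_integral => x _.
  by rewrite !posteriorE -EFinD; congr EFin; ring.
rewrite -DT => /(congr1 (fun e => e - D (A `*` [set true])))%E.
have Dfin : D (A `*` [set true]) \is a fin_num.
  by apply: fin_num_measure; exact: measurableX.
by rewrite addeAC subee// add0e addeAC subee// add0e.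
Qed.

(** Two transfers: restricting [D] to the label [y] and projecting gives [label_part D y], which has
    density [posterior eta y] with respect to the marginal. *)
Lemma integral_label (y : bool) (f : X -> \bar R) :
  measurable_fun setT f -> (forall x, 0 <= f x)%E ->
  (\int[D]_z ((\1_[set y] z.2)%:E * f z.1) =
   \int[marginal D]_x ((posterior eta y x)%:E * f x))%E.
Proof.
move=> mf f0; transitivity (\int[label_part D y]_x f x)%E.
  apply/esym/ge0_integral_transfer => //.
  - exact: measurableT_comp.
  - move=> A mA; rewrite -[LHS]/(D (A `*` [set y])) -[X in D X]setIT.
    rewrite -integral_indic//; last exact: measurableX.
    apply: eq_integral => -[x b] _; congr EFin.
    by rewrite !indicE in_setX /= mulrC; case: (_ \in _); case: (_ \in _);
      rewrite ?(mulr0, mulr1).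
apply: (@ge0_integral_transfer _ _ _ _ _ _ _ id) => //.
- exact: posterior_ge0.
- exact: label_part_posterior.
Qed.

Lemma class_size y : D (setT `*` [set y]) =
  (if y then base_rate D else 1 - base_rate D)%:E.
Proof.
have Dfin b : D (setT `*` [set b]) \is a fin_num.
  by apply: fin_num_measure; exact: measurableX.
rewrite /base_rate; case: y; first by rewrite fineK.
rewrite EFinB fineK//.
have -> : (1%:E = D (setT `*` [set false]) + D (setT `*` [set true]))%E.
  rewrite -measureU//; [|exact: measurableX..|]; last first.
    by apply/seteqP; split => // -[x b] /= [[_ ->] []].
  rewrite -(probability_setT D); congr (D _).
  by apply/seteqP; split => // -[x []] _; [right|left].
by rewrite addeK.
Qed.

Hypothesis base01 : 0 < base_rate D < 1.

Lemma class_condE y A : measurable A ->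
  class_cond D y A = (\int[marginal D]_x
    (posterior eta y x / (if y then base_rate D else 1 - base_rate D)
     * \1_A x)%:E)%E.
Proof.
move=> mA; set p := if y then _ else _.
have p0 : 0 < p.
  by case/andP: base01 => ? ?; rewrite /p; case: (y); rewrite ?subr_gt0.
have -> : class_cond D y A = ((p^-1)%:E * D (A `*` [set y]))%E.
  (* The class has positive finite mass, so [mnormalize] divides by it and does not return its
     default, the marginal. *)
  have normE m : m = p%:E ->
      ((if (m == 0) || (m == +oo) then marginal D : set X -> \bar R
        else fun U => label_part D y U * ((fine m)^-1)%:E) A
       = (p^-1)%:E * D (A `*` [set y]))%E.
    by move=> ->; rewrite eqe gt_eqF//= muleC.
  exact: (normE _ (class_size y)).
rewrite label_part_posterior// -ge0_integralZl//.
- by apply: eq_integral => x _; rewrite -EFinM mulrA [p^-1 * _]mulrC.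
- exact/measurable_EFinP/measurable_funM.
- by move=> x _; rewrite lee_fin mulr_ge0 ?posterior_ge0.
- by rewrite lee_fin invr_ge0 ltW.
Qed.

Lemma integral_class_cond y (f : X -> \bar R) :
  measurable_fun setT f -> (forall x, 0 <= f x)%E ->
  (\int[class_cond D y]_x f x = \int[marginal D]_x
    ((posterior eta y x / (if y then base_rate D else 1 - base_rate D))%:E
     * f x))%E.
Proof.
move=> mf f0.
apply: (@ge0_integral_transfer _ _ _ _ _ _ _ id) => //.
- by apply: measurable_funM.
- move=> x; rewrite divr_ge0 ?posterior_ge0//; case/andP: base01 => ? ?.
  by case: (y); rewrite ?subr_ge0 ltW.
- exact: class_condE.
Qed.

End class_probability.

(** * The loss on score differences *)

Section ell01.
Context {R : realType}.

Lemma ell01_ge0 (v : R) : 0 <= ell01 v.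
Proof. by rewrite addr_ge0// mulr_ge0// invr_ge0. Qed.

Lemma ell01N (v : R) : ell01 (- v) = 1 - ell01 v.
Proof. by rewrite /ell01 oppr_lt0 oppr_eq0; case: ltrgt0P => _ /=; lra. Qed.

Lemma ell01_le1 (v : R) : ell01 v <= 1.
Proof. by rewrite -subr_ge0 -ell01N ell01_ge0. Qed.

Lemma ell01_pos (v : R) : 0 < v -> ell01 v = 0.
Proof. by move=> v0; rewrite /ell01 ltNge ltW//= gt_eqF// mulr0 addr0. Qed.

Lemma ell01_neg (v : R) : v < 0 -> ell01 v = 1.
Proof. by move=> v0; rewrite /ell01 v0 lt_eqF// mulr0 addr0. Qed.

Lemma measurable_ell01 : measurable_fun setT (@ell01 R).
Proof.
rewrite (_ : @ell01 R = fun v => \1_(`]-oo, 0[) v + 2^-1 * \1_[set 0] v).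
  by apply: measurable_funD => //; exact: measurable_funM.
apply/funext => v; rewrite /ell01 !indicE.
congr ((nat_of_bool _)%:R + _ * (nat_of_bool _)%:R).
- by rewrite mem_setE in_itv.
- by apply/eqP/idP; rewrite inE.
Qed.

End ell01.

(** * Ranking risk as an integral over pairs *)

Section pair_risk.
Context {d} {X : measurableType d} {R : realType}.
Variables (M : probability X R).
Implicit Types (eta s : {mfun X >-> R}).

Definition pair_loss eta s (z : X * X) : R :=
  eta z.1 * (1 - eta z.2) * ell01 (s z.1 - s z.2).

Lemma measurable_pair_loss eta s : measurable_fun setT (pair_loss eta s).
Proof.
apply: measurable_funM.
  apply: measurable_funM; first exact: measurableT_comp.
  by apply: measurable_funB => //; exact: measurableT_comp.
apply: (measurableT_comp measurable_ell01).
by apply: measurable_funB; exact: measurableT_comp.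
Qed.

Lemma pair_loss_ge0 eta s z :
  (forall x, 0 <= eta x <= 1) -> 0 <= pair_loss eta s z.
Proof.
move=> eta01; rewrite mulr_ge0 ?ell01_ge0// mulr_ge0//.
  by have /andP[] := eta01 z.1.
by have := eta01 z.2; lra.
Qed.

Lemma pair_loss_le1 eta s z :
  (forall x, 0 <= eta x <= 1) -> pair_loss eta s z <= 1.
Proof.
move=> eta01; have /andP[e0 e1] := eta01 z.1; have /andP[e2 e3] := eta01 z.2.
rewrite -[leRHS](mulr1 1) ler_pM ?ell01_ge0 ?ell01_le1//.
  by rewrite mulr_ge0// subr_ge0.
rewrite -[leRHS](mulr1 1) ler_pM//; first by rewrite subr_ge0.
by rewrite gerBl.
Qed.

Definition pair_risk eta s : \bar R :=
  (\int[M \x M]_z (pair_loss eta s z)%:E)%E.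

Definition sym_loss eta s (z : X * X) : R :=
  pair_loss eta s z + pair_loss eta s (z.2, z.1).

Lemma pair_risk_sym eta s : (forall x, 0 <= eta x <= 1) ->
  (pair_risk eta s + pair_risk eta s =
   \int[M \x M]_z (sym_loss eta s z)%:E)%E.
Proof.
move=> eta01.
have mL : measurable_fun setT (fun z => (pair_loss eta s z)%:E).
  by apply/measurable_EFinP; exact: measurable_pair_loss.
have L0 z : (0 <= (pair_loss eta s z)%:E)%E by rewrite lee_fin pair_loss_ge0.
have mL' : measurable_fun setT (fun z => (pair_loss eta s (z.2, z.1))%:E).
  apply: (measurableT_comp mL).
  exact: measurable_fun_pair.
under [RHS]eq_integral do rewrite EFinD.
rewrite ge0_integralD//; congr (_ + _)%E.
(* Both factors are [M], so swapping the coordinates amounts to exchanging the order of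
   integration. *)
rewrite /pair_risk fubini_tonelli1// fubini_tonelli2//.
Qed.

End pair_risk.

(** The class-conditional laws have densities [eta / pi] and [(1 - eta) / (1 - pi)] with respect to
    the marginal; the constants come out of the iterated integral. *)
Lemma rank_riskE {d} {X : measurableType d} {R : realType}
    (D : probability (X * bool)%type R) (eta s : {mfun X >-> R}) :
  is_class_prob D eta -> 0 < base_rate D < 1 ->
  (rank_risk s D = ((base_rate D * (1 - base_rate D))^-1)%:E
     * pair_risk (marginal D) eta s)%E.
Proof.
move=> etaP base01; rewrite /rank_risk unlock.
have mell : measurable_fun setT (fun z : X * X => (ell01 (s z.1 - s z.2))%:E).
  apply/measurable_EFinP/(measurableT_comp measurable_ell01).
  by apply: measurable_funB; exact: measurableT_comp.
have ell0 (v : R) : (0 <= (ell01 v)%:E)%E by rewrite lee_fin ell01_ge0.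
have mell1 x : measurable_fun setT (fun y => (ell01 (s x - s y))%:E).
  exact: (measurableT_comp mell (measurable_pair1 x)).
have p0 y x : 0 <= posterior eta y x by exact: (posterior_ge0 _ _ etaP).
have [b_gt0 b_lt1] := andP base01.
have b0 : 0 <= 1 - base_rate D by rewrite subr_ge0 ltW.
have b1 : 0 <= base_rate D by exact: ltW.
have b2 : base_rate D != 0 by rewrite gt_eqF.
have b3 : 1 - base_rate D != 0 by rewrite gt_eqF// subr_gt0.
transitivity (\int[class_cond D true]_x \int[class_cond D false]_y
    (ell01 (s x - s y))%:E)%E.
  exact: (fubini_tonelli1 _ mell (fun=> ell0 _)).
rewrite (integral_class_cond _ _ etaP base01); last 2 first.
- exact: (measurable_fun_fubini_tonelli_F _ mell).
- by move=> x; apply: integral_ge0 => y _; exact: ell0.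
have mL : measurable_fun setT (fun z => (pair_loss eta s z)%:E).
  by apply/measurable_EFinP; exact: measurable_pair_loss.
have L0 z : (0 <= (pair_loss eta s z)%:E)%E.
  by rewrite lee_fin pair_loss_ge0//; exact: etaP.1.
rewrite /pair_risk fubini_tonelli1//.
rewrite -ge0_integralZl//; last 3 first.
- exact: measurable_fun_fubini_tonelli_F.
- by move=> x _; apply: integral_ge0.
- by rewrite lee_fin invr_ge0 mulr_ge0.
apply: eq_integral => x _; rewrite /fubini_F.
rewrite (integral_class_cond _ _ etaP base01)// -!ge0_integralZl//.
- apply: eq_integral => y _; rewrite !posteriorE -!EFinM; congr EFin.
  by rewrite /pair_loss/=; field; apply/andP.
- by apply: emeasurable_funM => //; apply/measurable_EFinP/measurable_funM.
- by move=> y _; rewrite mule_ge0// lee_fin divr_ge0.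
- by rewrite lee_fin divr_ge0.
- exact: (measurableT_comp mL (measurable_pair1 x)).
- by rewrite lee_fin invr_ge0 mulr_ge0.
Qed.

(** * The class-probability function after noise *)

Section noise.
Context {d} {X : measurableType d} {R : realType}.
Variables (D : probability (X * bool)%type R) (eta rhoN rhoP : {mfun X >-> R}).
Hypothesis etaP : is_class_prob D eta.
Hypothesis rhoN01 : forall x, 0 <= rhoN x <= 1.
Hypothesis rhoP01 : forall x, 0 <= rhoP x <= 1.

Definition noisy_eta : {mfun X >-> R} := eta * (1 - rhoP) + (1 - eta) * rhoN.

Lemma noisy_etaE x :
  noisy_eta x = eta x * (1 - rhoP x) + (1 - eta x) * rhoN x.
Proof. by []. Qed.

Lemma marginal_ILN A : measurable A ->
  marginal (ILN D rhoN rhoP) A = marginal D A.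
Proof.
move=> mA; have mA1 : measurable ((fst : X * bool -> X) @^-1` A).
  by rewrite -[X in measurable X]setTI; exact: measurable_fst.
rewrite -[RHS]/(D (fst @^-1` A)) -[in RHS](setIT (_ @^-1` _)).
rewrite -integral_indic//; apply: eq_integral => z _ /=.
have [Az|nAz] := pselect (A z.1).
  rewrite indicE mem_set// (_ : [set _ | _] = setT) ?probability_setT//.
  by apply/seteqP; split.
rewrite indicE memNset// (_ : [set _ | _] = set0) ?measure0//.
by apply/seteqP; split.
Qed.

Lemma ILN_positive A : measurable A ->
  ILN D rhoN rhoP (A `*` [set true]) =
  (\int[marginal D]_(x in A) (noisy_eta x)%:E)%E.
Proof.
move=> mA; rewrite integral_mkcond.
have mP : measurable_fun setT (fun x => ((1 - rhoP x) * \1_A x)%:E).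
  by apply/measurable_EFinP/measurable_funM => //; exact: measurable_funB.
have mN : measurable_fun setT (fun x => (rhoN x * \1_A x)%:E).
  exact/measurable_EFinP/measurable_funM.
have P0 x : (0 <= ((1 - rhoP x) * \1_A x)%:E)%E.
  by rewrite lee_fin mulr_ge0//; have := rhoP01 x; lra.
have N0 x : (0 <= (rhoN x * \1_A x)%:E)%E.
  by rewrite lee_fin mulr_ge0//; have := rhoN01 x; lra.
have mlab b : measurable_fun setT (fun z : X * bool => (\1_[set b] z.2 : R)%:E).
  by apply/measurable_EFinP/measurableT_comp.
(* A noisy positive is a clean positive that is kept or a clean negative that is flipped. *)
transitivity (\int[D]_z (
    (\1_[set true] z.2)%:E * ((1 - rhoP z.1) * \1_A z.1)%:E
    + (\1_[set false] z.2)%:E * (rhoN z.1 * \1_A z.1)%:E))%E.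
  apply: eq_integral => -[x y] _ /=.
  (* Since the rates lie in [0, 1], [bernoulli_prob] is the mixture of two Dirac masses and not its
     default. *)
  rewrite bernoulli_probE; last by rewrite /flip_rate; case: ifP.
  rewrite !diracE /flip_rate/= !indicE -!EFinM -!EFinD; congr EFin.
  have memE b : (b \in [set c | A x /\ y (+) c = true]) =
      (x \in A) && (y (+) b).
    by apply/idP/andP; rewrite !inE.
  have mem1 b : (y \in [set b]) = (y == b) by apply/idP/eqP; rewrite inE.
  rewrite !memE !mem1 /unstable.onem.
  by case: y {memE mem1}; case: (x \in A) => /=; ring.
rewrite ge0_integralD//.
- rewrite (integral_label _ _ etaP true
    (fun x => ((1 - rhoP x) * \1_A x)%:E))//.
  rewrite (integral_label _ _ etaP false (fun x => (rhoN x * \1_A x)%:E))//.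
  rewrite -ge0_integralD//.
  + apply: eq_integral => x _; rewrite epatch_indic !posteriorE.
    by rewrite -!EFinM -EFinD noisy_etaE; congr EFin; ring.
  + by move=> x _; rewrite mule_ge0// lee_fin; exact: (posterior_ge0 _ _ etaP).
  + by apply: emeasurable_funM => //; exact/measurable_EFinP.
  + by move=> x _; rewrite mule_ge0// lee_fin; exact: (posterior_ge0 _ _ etaP).
  + by apply: emeasurable_funM => //; exact/measurable_EFinP.
- by move=> z _; rewrite mule_ge0// lee_fin.
- by apply: emeasurable_funM => //; apply: (measurableT_comp mP).
- by move=> z _; rewrite mule_ge0// lee_fin.
- by apply: emeasurable_funM => //; apply: (measurableT_comp mN).
Qed.

Lemma is_class_prob_ILN : is_class_prob (ILN D rhoN rhoP) noisy_eta.
Proof.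
split=> [x|A mA].
  rewrite noisy_etaE; have := etaP.1 x; have := rhoN01 x; have := rhoP01 x.
  move=> /andP[? ?] /andP[? ?] /andP[? ?].
  by apply/andP; split; nra.
apply: etrans (ILN_positive _ mA) _; apply: eq_measure_integral => B mB _.
by apply/esym/marginal_ILN.
Qed.

End noise.

(** * Pointwise comparison of clean and noisy regrets *)

(** At the point with the larger class probability [e], the labels +1 and -1 flip at rates [f] and
    [g]; primes mark the other point. The proof splits on the position of 1/2 relative to [e'] and
    [e]. *)
Lemma flipped_gap {R : realFieldType} (c e e' f g f' g' : R) :
  e' < e -> g + f <= 1 - c -> g' + f' <= 1 - c -> f - g <= f' - g' ->
  (e <= 2^-1 -> f' <= f /\ g' <= g) -> (2^-1 <= e' -> f <= f' /\ g <= g') ->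
  c * (e - e') <=
    (e * (1 - f) + (1 - e) * g) - (e' * (1 - f') + (1 - e') * g').
Proof.
move=> ee n n' dl low high.
have [le|gt] := lerP e 2^-1.
  (* With [S = (f - f') + (g - g')], the right side is [(1 - f - g) (e - e') + (1/2 - e') S + ((f' -
     g') - (f - g)) / 2], whose last two terms are nonnegative. The case where both exceed 1/2 is
     the mirror image. *)
  have [P1 N1] := low le.
  have k : 0 <= (1 - c - f - g) * (e - e') by rewrite mulr_ge0//; lra.
  have m : 0 <= (2^-1 - e') * ((f - f') + (g - g')) by rewrite mulr_ge0//; lra.
  lra.
(* When [e'] and [e] straddle 1/2, center both at 1/2: [e (1 - f) + (1 - e) g]
   is [1/2 + (1 - f - g) (e - 1/2) + (g - f) / 2]. *)
have [le'|gt'] := lerP e' 2^-1.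
  have m1 : 0 <= (1 - c - f - g) * (e - 2^-1) by rewrite mulr_ge0//; lra.
  have m2 : 0 <= (1 - c - f' - g') * (2^-1 - e') by rewrite mulr_ge0//; lra.
  lra.
have [P2 N2] := high (ltW gt').
have k' : 0 <= (1 - c - f' - g') * (e - e') by rewrite mulr_ge0//; lra.
have m : 0 <= (e - 2^-1) * ((f' - f) + (g' - g)) by rewrite mulr_ge0//; lra.
lra.
Qed.

(** [a] and [b] are the clean and noisy gaps, [u] and [v] the losses of the scorer and of a
    competitor. If [a] is nonzero, [b] has its sign and at least [c] times its size, and [ell01 b]
    is the end of [0, 1] that minimizes [b * w] over [w]. If [a = 0], the left side vanishes and the
    right side is nonnegative. *)
Lemma ell01_regret {R : realType} (c a b u v : R) :
  0 < c -> 0 <= u <= 1 -> 0 <= v <= 1 ->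
  (0 < a -> c * a <= b) -> (a < 0 -> b <= c * a) ->
  c * (a * (u - v)) <= b * (u - ell01 b).
Proof.
move=> c0 /andP[u0 u1] /andP[v0 v1] pos neg.
have [lt|gt|->] := ltrgtP a 0.
- have ca : 0 < c * - a by rewrite mulr_gt0// oppr_gt0.
  have {}neg := neg lt.
  rewrite ell01_neg; last lra.
  have m1 : 0 <= c * - a * (1 - v) by rewrite mulr_ge0 ?subr_ge0 ?(ltW ca).
  have m2 : 0 <= (c * a - b) * (1 - u) by rewrite mulr_ge0//; lra.
  lra.
- have ca : 0 < c * a by rewrite mulr_gt0.
  have {}pos := pos gt.
  rewrite ell01_pos; last lra.
  have m1 : 0 <= c * a * v by rewrite mulr_ge0 ?(ltW ca).
  have m2 : 0 <= (b - c * a) * u by rewrite mulr_ge0//; lra.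
  lra.
rewrite mul0r mulr0; have [lt|gt|->] := ltrgtP b 0; last by rewrite mul0r.
- by rewrite ell01_neg// nmulr_rge0// subr_le0.
- by rewrite ell01_pos// subr0 mulr_ge0// ltW.
Qed.

Section noisy_order.
Context {d} {X : measurableType d} {R : realType}.
Variables (eta s0 : {mfun X >-> R}) (fN fP : {mfun R >-> R}) (c : R).
Hypothesis c_gt0 : 0 < c.
Hypothesis adm : BCNplus_admissible fN fP s0 eta.
Hypothesis noise_le : forall x, fN (s0 x) + fP (s0 x) <= 1 - c.
Let etab := noisy_eta eta (fN \o s0) (fP \o s0).

Lemma noisy_eta_gap x x' : eta x' < eta x ->
  c * (eta x - eta x') <= etab x - etab x'.
Proof.
case: adm => eta_s0 mono delta lt_eta.
have le_s0 := ltW (eta_s0 _ _ lt_eta).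
have [N1 N2] := mono false _ _ le_s0; have [P1 P2] := mono true _ _ le_s0.
apply: flipped_gap => //; [exact: noise_le|exact: noise_le|exact: delta|..].
  move=> le; have le' := ltW (lt_le_trans lt_eta le).
  by split; [exact: P1|exact: N1].
move=> ge; have ge' := ltW (le_lt_trans ge lt_eta).
by split; [exact: P2|exact: N2].
Qed.

Lemma sym_lossE (h t : {mfun X >-> R}) x y : sym_loss h t (x, y) =
  (h x - h y) * ell01 (t x - t y) + h y * (1 - h x).
Proof.
rewrite /sym_loss /pair_loss/= -(opprB (t x)) ell01N; ring.
Qed.

(** By [sym_lossE] the terms free of the scorer cancel, leaving [ell01_regret]. Written as sums of
    nonnegative terms, the inequality integrates without any subtraction in [\bar R]. *)
Lemma sym_loss_regret (s t : {mfun X >-> R}) z :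
  c * sym_loss eta s z + sym_loss etab etab z <=
  sym_loss etab s z + c * sym_loss eta t z.
Proof.
case: z => x y; rewrite !sym_lossE.
have ell01_itv (v : R) : 0 <= ell01 v <= 1 by rewrite ell01_ge0 ell01_le1.
have := @ell01_regret _ c (eta x - eta y) (etab x - etab y)
  (ell01 (s x - s y)) (ell01 (t x - t y)) c_gt0 (ell01_itv _) (ell01_itv _).
have pos : 0 < eta x - eta y -> c * (eta x - eta y) <= etab x - etab y.
  by rewrite subr_gt0; exact: noisy_eta_gap.
have neg : eta x - eta y < 0 -> etab x - etab y <= c * (eta x - eta y).
  by rewrite subr_lt0 => /noisy_eta_gap; rewrite -lerN2 -mulrN !opprB.
move=> /(_ pos neg); set w := ell01 (etab x - etab y).
set u := ell01 (s x - s y); set v := ell01 (t x - t y).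
rewrite -subr_ge0 => wuv; rewrite -subr_ge0; apply: (le_trans wuv).
by rewrite le_eqVlt; apply/orP; left; apply/eqP; ring.
Qed.

End noisy_order.

(** * Finiteness of the risks and of their infimum *)

Section finite_risk.
Context {d} {X : measurableType d} {R : realType}.

Lemma pair_risk_fin_num (M : probability X R) (eta s : {mfun X >-> R}) :
  (forall x, 0 <= eta x <= 1) -> pair_risk M eta s \is a fin_num.
Proof.
move=> eta01; have L0 z : (0 <= (pair_loss eta s z)%:E)%E.
  by rewrite lee_fin pair_loss_ge0.
rewrite ge0_fin_numE; last exact: integral_ge0.
apply: (@le_lt_trans _ _ (\int[M \x M]_z (cst 1%E z))%E).
  apply: ge0_le_integral => //.
  - by apply/measurable_EFinP; exact: measurable_pair_loss.
  - by move=> z _; rewrite lee_fin pair_loss_le1.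
rewrite integral_cst// mul1e.
by apply: (le_lt_trans (probability_le1 _ _)); rewrite ?ltry.
Qed.

(** This serves to replace the marginal of the noisy law by that of [D], with which it agrees on
    measurable sets. Iterated integrals allow one factor to be changed at a time. *)
Lemma eq_pair_risk (M M' : probability X R) (eta s : {mfun X >-> R}) :
  (forall x, 0 <= eta x <= 1) -> (forall A, measurable A -> M A = M' A) ->
  pair_risk M eta s = pair_risk M' eta s.
Proof.
move=> eta01 MM'; have L0 z : (0 <= (pair_loss eta s z)%:E)%E.
  by rewrite lee_fin pair_loss_ge0.
have mL : measurable_fun setT (fun z => (pair_loss eta s z)%:E).
  by apply/measurable_EFinP; exact: measurable_pair_loss.
rewrite /pair_risk !fubini_tonelli1//.
transitivity (\int[M']_x fubini_F M (EFin \o pair_loss eta s) x)%E.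
  by apply: eq_measure_integral => A mA _; exact: MM'.
by apply: eq_integral => x _; apply: eq_measure_integral => A mA _; exact: MM'.
Qed.

Lemma rank_risk_fin_num (D : probability (X * bool)%type R)
    (eta s : {mfun X >-> R}) :
  is_class_prob D eta -> 0 < base_rate D < 1 -> rank_risk s D \is a fin_num.
Proof.
move=> etaP base01; rewrite (rank_riskE _ _ _ etaP base01).
by rewrite fin_numM// pair_risk_fin_num//; exact: etaP.1.
Qed.

Lemma rank_risk_ge0 (D : probability (X * bool)%type R) (s : {mfun X >-> R}) :
  (0 <= rank_risk s D)%E.
Proof.
rewrite /rank_risk unlock; apply: integral_ge0 => z _.
by rewrite lee_fin ell01_ge0.
Qed.

Lemma inf_rank_risk_fin_num (D : probability (X * bool)%type R)
    (eta : {mfun X >-> R}) :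
  is_class_prob D eta -> 0 < base_rate D < 1 ->
  ereal_inf [set rank_risk t D | t in [set: {mfun X >-> R}]] \is a fin_num.
Proof.
move=> etaP base01; rewrite ge0_fin_numE; last first.
  by apply/ereal_infP => _ [t _ <-]; exact: rank_risk_ge0.
apply: (@le_lt_trans _ _ (rank_risk eta D)).
  by apply: ereal_inf_lbound; exists eta.
by rewrite -ge0_fin_numE ?rank_risk_ge0// (rank_risk_fin_num _ _ _ etaP base01).
Qed.

End finite_risk.

(** * Nondegeneracy of the noisy law and the integrated comparison *)

Section noisy_risk.
Context {d} {X : measurableType d} {R : realType}.
Variables (D : probability (X * bool)%type R) (eta s0 : {mfun X >-> R}).
Variables (fN fP : {mfun R >-> R}) (c : R).
Hypothesis c_gt0 : 0 < c.
Hypothesis etaP : is_class_prob D eta.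
Hypothesis base01 : 0 < base_rate D < 1.
Hypothesis fN01 : forall z, 0 <= fN z <= 1.
Hypothesis fP01 : forall z, 0 <= fP z <= 1.
Hypothesis adm : BCNplus_admissible fN fP s0 eta.
Hypothesis noise_le : forall x, fN (s0 x) + fP (s0 x) <= 1 - c.
Let etab := noisy_eta eta (fN \o s0) (fP \o s0).
Let Dbar := BCNplus D fN fP s0.

Let etabP : is_class_prob Dbar etab.
Proof. by apply: is_class_prob_ILN => // x; [exact: fN01|exact: fP01]. Qed.

Lemma class_size_posterior (D' : probability (X * bool)%type R)
    (eta' : {mfun X >-> R}) y : is_class_prob D' eta' ->
  (D' (setT `*` [set y]) = \int[marginal D']_x (posterior eta' y x)%:E)%E.
Proof.
move=> eta'P; rewrite (label_part_posterior _ _ eta'P)//.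
by apply: eq_integral => x _; rewrite indicT mulr1.
Qed.

(** The two flip rates are nonnegative with sum at most [1 - c], so each label survives with
    probability at least [c]. Integrated, this keeps the noisy base rate strictly between 0 and
    1. *)
Lemma posterior_noisy_ge y x : c * posterior eta y x <= posterior etab y x.
Proof.
have keep (e f g : R) : 0 <= e <= 1 -> 0 <= f -> 0 <= g -> g + f <= 1 - c ->
    c * e <= e * (1 - f) + (1 - e) * g.
  move=> /andP[e0 e1] f0 g0 gf.
  have m1 : 0 <= e * (1 - c - f) by rewrite mulr_ge0//; lra.
  have m2 : 0 <= (1 - e) * g by rewrite mulr_ge0//; lra.
  lra.
have /andP[f0 _] := fP01 (s0 x); have /andP[g0 _] := fN01 (s0 x).
have /andP[e0 e1] := etaP.1 x.
rewrite !posteriorE; case: y; first exact: keep (etaP.1 x) f0 g0 (noise_le x).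
(* The label -1 is the same situation with [eta] replaced by [1 - eta] and the two rates
   exchanged. *)
have -> : 1 - etab x =
    (1 - eta x) * (1 - fN (s0 x)) + (1 - (1 - eta x)) * fP (s0 x).
  by rewrite /etab noisy_etaE/=; ring.
apply: keep => //; first by rewrite subr_ge0 e1 gerBl.
by rewrite addrC; exact: noise_le.
Qed.

Lemma class_size_noisy_ge y :
  (c%:E * D (setT `*` [set y]) <= Dbar (setT `*` [set y]))%E.
Proof.
rewrite !(class_size_posterior _ _ _ etaP, class_size_posterior _ _ _ etabP).
have -> : (\int[marginal Dbar]_x (posterior etab y x)%:E =
  \int[marginal D]_x (posterior etab y x)%:E)%E.
  by apply: eq_measure_integral => A mA _; exact: marginal_ILN.
rewrite -ge0_integralZl//.
- apply: ge0_le_integral => //.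
  + move=> x _; rewrite lee_fin mulr_ge0 ?(ltW c_gt0)//.
    exact: (posterior_ge0 _ _ etaP).
  + by apply: emeasurable_funM => //; exact/measurable_EFinP.
  + exact/measurable_EFinP.
  + by move=> x _; rewrite lee_fin posterior_noisy_ge.
- exact/measurable_EFinP.
- by move=> x _; rewrite lee_fin (posterior_ge0 _ _ etaP).
- by rewrite lee_fin ltW.
Qed.

Lemma base_rate_noisy : 0 < base_rate Dbar < 1.
Proof.
have /andP[b0 b1] := base01.
have := class_size_noisy_ge true; have := class_size_noisy_ge false.
rewrite !class_size -!EFinM !lee_fin => le1 le0.
apply/andP; split; first by apply: lt_le_trans le0; rewrite mulr_gt0.
by rewrite -subr_gt0; apply: lt_le_trans le1; rewrite mulr_gt0// subr_gt0.
Qed.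

Lemma pair_risk_regret (s t : {mfun X >-> R}) :
  (c%:E * pair_risk (marginal D) eta s + pair_risk (marginal D) etab etab <=
   pair_risk (marginal D) etab s + c%:E * pair_risk (marginal D) eta t)%E.
Proof.
have eta01 := etaP.1; have etab01 := etabP.1.
have KE (h u : {mfun X >-> R}) : (forall x, 0 <= h x <= 1) ->
    (2%:E * pair_risk (marginal D) h u =
    \int[marginal D \x marginal D]_z (sym_loss h u z)%:E)%E.
  by move=> h01; rewrite -pair_risk_sym// mule_natl mule2n.
have mS (h u : {mfun X >-> R}) :
    measurable_fun setT (fun z => (sym_loss h u z)%:E : \bar R).
  apply/measurable_EFinP/measurable_funD; first exact: measurable_pair_loss.
  apply: (measurableT_comp (measurable_pair_loss h u)).
  exact: measurable_fun_pair.
have S0 (h u : {mfun X >-> R}) : (forall x, 0 <= h x <= 1) ->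
    forall z, (0 <= (sym_loss h u z)%:E)%E.
  by move=> h01 z; rewrite lee_fin addr_ge0// pair_loss_ge0.
have c0 : (0 <= c%:E)%E by rewrite lee_fin ltW.
have cS0 (h u : {mfun X >-> R}) : (forall x, 0 <= h x <= 1) ->
    forall z, (0 <= c%:E * (sym_loss h u z)%:E)%E.
  by move=> h01 z; rewrite mule_ge0// S0.
have mcS (h u : {mfun X >-> R}) :
    measurable_fun setT (fun z => c%:E * (sym_loss h u z)%:E)%E.
  exact: emeasurable_funM.
have cS (h u : {mfun X >-> R}) : (forall x, 0 <= h x <= 1) ->
    (2%:E * (c%:E * pair_risk (marginal D) h u) =
    \int[marginal D \x marginal D]_z (c%:E * (sym_loss h u z)%:E))%E.
  by move=> h01; rewrite muleCA KE// -ge0_integralZl// => z _; exact: S0.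
have mule2D (x y : \bar R) : (2%:E * (x + y) = 2%:E * x + 2%:E * y)%E.
  by rewrite !mule_natl !mule2n addeACA.
(* Doubling turns every pair risk into an integral of [sym_loss], where the pointwise inequality
   applies. *)
rewrite -(@lee_pmul2l _ 2%:E)//.
rewrite (mule2D (_ * _)%E) (mule2D _ (_ * _)%E) !cS// !KE//.
rewrite -!ge0_integralD//; try by move=> z _; rewrite ?S0 ?cS0.
apply: ge0_le_integral => //.
- by move=> z _; rewrite adde_ge0 ?S0 ?cS0.
- exact: emeasurable_funD.
- exact: emeasurable_funD.
- by move=> z _; rewrite -!EFinM -!EFinD lee_fin; exact: sym_loss_regret.
Qed.

End noisy_risk.

(** * From pair risks to regrets *)

Lemma noise_le_rho_max {d} {X : measurableType d} {R : realType}
    (rhoN rhoP : X -> R) x :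
  (forall y, 0 <= rhoN y <= 1) -> (forall y, 0 <= rhoP y <= 1) ->
  rhoN x + rhoP x <= 2 * rho_max rhoN rhoP.
Proof.
move=> N01 P01; rewrite /rho_max mulrA divff// mul1r addrC.
apply: ub_le_sup; last by exists x.
(* Each rate is at most 1, so the range is bounded and its [sup] is a true upper bound. *)
exists (1 + 1) => _ [y _ <-].
by rewrite lerD//; [have /andP[] := P01 y|have /andP[] := N01 y].
Qed.

Theorem proposition8 (R : realType) (d : measure_display) (X : measurableType d)
  (D : probability (X * bool)%type R) (eta : {mfun X >-> R})
  (fN fP : {mfun R >-> R}) (s0 : {mfun X >-> R})
  (h_eta : is_class_prob D eta)
  (h_pi : 0 < base_rate D < 1)
  (h_fN : forall z, 0 <= fN z <= 1)
  (h_fP : forall z, 0 <= fP z <= 1)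
  (h_adm : BCNplus_admissible fN fP s0 eta)
  (h_rho : rho_max (fN \o s0) (fP \o s0) < 2^-1)
  (s : {mfun X >-> R}) :
  let Dbar := BCNplus D fN fP s0 in
  let pi := base_rate D in
  let pibar := base_rate Dbar in
  (rank_regret s D <=
     (pibar * (1 - pibar) / (pi * (1 - pi))
        * (1 / (1 - 2 * rho_max (fN \o s0) (fP \o s0))))%:E
     * rank_regret s Dbar)%E.
Proof.
cbv zeta; set Dbar := BCNplus D fN fP s0; set pi := base_rate D.
set pibar := base_rate Dbar; set c := 1 - 2 * _.
have c_gt0 : 0 < c by rewrite subr_gt0 mulrC -ltr_pdivlMr// mul1r.
have noise_le x : fN (s0 x) + fP (s0 x) <= 1 - c.
  rewrite /c subKr.
  apply: (noise_le_rho_max (fN \o s0) (fP \o s0)) => y; last exact: h_fP.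
  exact: h_fN.
pose etab := noisy_eta eta (fN \o s0) (fP \o s0).
have etabP : is_class_prob Dbar etab.
  by apply: is_class_prob_ILN => // x; [exact: h_fN|exact: h_fP].
have pibar01 : 0 < base_rate Dbar < 1.
  exact: (base_rate_noisy _ _ _ _ _ c c_gt0 h_eta h_pi).
have A0 : 0 < pi * (1 - pi).
  by case/andP: h_pi => ? ?; rewrite mulr_gt0// subr_gt0.
have B0 : 0 < pibar * (1 - pibar).
  by case/andP: pibar01 => ? ?; rewrite mulr_gt0// subr_gt0.
set A := pi * (1 - pi) in A0 *; set B := pibar * (1 - pibar) in B0 *.
(* All pair risks are finite; passing to their real values leaves only real arithmetic, with [A] and
   [B] the clean and noisy normalizations. *)
pose k (h u : {mfun X >-> R}) := fine (pair_risk (marginal D) h u).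
have kE (h u : {mfun X >-> R}) : (forall x, 0 <= h x <= 1) ->
    pair_risk (marginal D) h u = (k h u)%:E.
  by move=> h01; rewrite fineK// pair_risk_fin_num.
have [eta01 etab01] := (h_eta.1, etabP.1).
have riskE u : rank_risk u D = (A^-1 * k eta u)%:E.
  by rewrite (rank_riskE _ _ _ h_eta h_pi) EFinM kE.
have riskbE u : rank_risk u Dbar = (B^-1 * k etab u)%:E.
  rewrite (rank_riskE _ _ _ etabP pibar01) EFinM -kE//.
  congr (_ * _)%E; apply: eq_pair_risk => //.
  by move=> E mE; exact: marginal_ILN.
have regret_le u : c * k eta s + k etab etab <= k etab s + c * k eta u.
  have := pair_risk_regret _ _ _ _ _ c c_gt0 h_eta h_fN h_fP h_adm noise_le s u.
  by rewrite !kE// -!EFinM -!EFinD lee_fin.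
rewrite /rank_regret.
have := inf_rank_risk_fin_num _ _ h_eta h_pi.
have := inf_rank_risk_fin_num _ _ etabP pibar01.
set ib := ereal_inf _; set i := ereal_inf _ => ib_fin i_fin.
have ib_le : fine ib <= B^-1 * k etab etab.
  rewrite -lee_fin fineK// -riskbE.
  by apply: ereal_inf_lbound; exists etab.
rewrite riskE riskbE -(fineK ib_fin) -(fineK i_fin) -!EFinB -EFinM lee_fin.
(* Isolating the clean infimum makes the goal a lower bound on it, to be checked against each
   competitor [u]. *)
rewrite lerBlDr addrC -lerBlDr -lee_fin (fineK i_fin).
apply/ereal_infP => _ [u _ <-]; rewrite riskE lee_fin.
have regretE : (c * A)^-1 * (c * k eta s - c * k eta u)
    <= (c * A)^-1 * (B * (B^-1 * k etab s - fine ib)).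
  apply: ler_wpM2l; first by rewrite invr_ge0 ltW// mulr_gt0.
  apply: (@le_trans _ _ (k etab s - k etab etab)).
    by rewrite lerBlDr addrAC lerBrDr regret_le.
  have := ler_wpM2l (ltW B0) ib_le; rewrite mulVKf ?gt_eqF// => ib_le'.
  by rewrite mulrBr mulVKf ?gt_eqF// lerB.
have -> : A^-1 * k eta s - B / A * (1 / c) * (B^-1 * k etab s - fine ib) =
    A^-1 * k eta s - (c * A)^-1 * (B * (B^-1 * k etab s - fine ib)).
  by field; rewrite !gt_eqF.
rewrite lerBlDr -lerBlDl; apply: le_trans regretE.
by rewrite le_eqVlt; apply/orP; left; apply/eqP; field; rewrite !gt_eqF.
Qed.
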